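(* Let $P\subset\mathbb R^d$ be a convex $d$-polytope in transverse antipodal position. Then \[ \sum_{(F,G)\ \mathrm{exact}}(-1)^{d-1-\dim F-\dim G}=1+(-1)^{d-1}, \] where the sum is over all exact ordered antipodal pairs $(F,G)$ of proper faces of $P$.
   Context: A convex $d$-polytope $P\subset\mathbb R^d$ is a full-dimensional (compact) convex polytope. For $u\in S^{d-1}$, $F_P(u)=\{x\in P:\langle u,x\rangle=\max_{y\in P}\langle u,y\rangle\}$. For a nonempty proper face $F$ of $P$, its exact spherical normal cell is $N^\circ(F)=\{u\in S^{d-1}:F_P(u)=F\}$, and $-N^\circ(F)=\{-u:u\in N^\circ(F)\}$. An ordered pair $(F,G)$ of nonempty proper faces is an exact ordered antipodal pair if $N^\circ(F)\cap(-N^\circ(G))\neq\varnothing$, i.e. there is $u\in S^{d-1}$ with $F_P(u)=F$ and $F_P(-u)=G$. $P$ is in transverse antipodal position if, for every exact ordered antipodal pair $(F,G)$, the intersection $N^\circ(F)\cap(-N^\circ(G))$ is a relatively open cell of dimension $d-1-\dim F-\dim G$ (in particular exact intersections occur only when $\dim F+\dim G\le d-1$). *)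

(* Defs.v *)
From HB Require Import structures.
From mathcomp Require Import all_boot all_order all_algebra.
From mathcomp Require Import all_classical all_reals all_analysis.

Set Implicit Arguments.
Unset Strict Implicit.
Unset Printing Implicit Defensive.

Import Order.TTheory GRing.Theory Num.Theory.
Import numFieldNormedType.Exports.

Local Open Scope classical_set_scope.
Local Open Scope ring_scope.

Section Antipodal.
Context {R : realType} {d : nat}.
Local Notation V := 'rV[R]_d.

Implicit Types (A C P F G : set V) (u v x y : V).

Definition dotp u v : R := (u *m v^T) 0 0.

(* The Euclidean unit sphere; the library norm `|u| on row vectors is the sup
   norm, so it cannot be used here. *)
Definition usphere : set V := [set u | dotp u u = 1].

Definition convhull n (p : 'I_n -> V) : set V :=
  [set x | exists w : 'I_n -> R,
    [/\ forall i, 0 <= w i, \sum_i w i = 1 & x = \sum_i w i *: p i]].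

Definition affhull A : set V :=
  [set x | exists n (p : 'I_n -> V) (w : 'I_n -> R),
    [/\ forall i, A (p i), \sum_i w i = 1 & x = \sum_i w i *: p i]].

(* The dimension of the affine hull, i.e. of its direction space W. The value
   is -1 for A = set0, whose affine hull has no direction space. *)
Definition affdim A : int :=
  xget (-1) [set k : int | exists (x0 : V) (W : {vspace V}),
    affhull A = [set x | x - x0 \in W] /\ k = (\dim W)%:Z].

Definition convex_dpolytope P : Prop :=
  (exists n (p : 'I_n -> V), P = convhull p) /\ affdim P = d%:Z.

Definition is_face P F : Prop :=
  exists (c : V) (b : R), (forall x, P x -> dotp c x <= b) /\
    F = P `&` [set x | dotp c x = b].

Definition nonempty_proper_face P F : Prop :=
  [/\ is_face P F, F !=set0 & F <> P].

Definition support_face P u : set V :=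
  [set x | P x /\ forall y, P y -> dotp u y <= dotp u x].

Definition normal_cell P F : set V :=
  [set u | usphere u /\ support_face P u = F].

Definition antipodal_cell P F G : set V :=
  normal_cell P F `&` [set - u | u in normal_cell P G].

Definition exact_antipodal P : set (set V * set V) :=
  [set FG | [/\ nonempty_proper_face P FG.1, nonempty_proper_face P FG.2 &
    antipodal_cell P FG.1 FG.2 !=set0]].

(* No two antipodal points, and the minimal great-circle arc joining any two
   points of C lies in C. *)
Definition spherically_convex C : Prop :=
  (forall u, C u -> ~ C (- u)) /\
  (forall u v x (s t : R), C u -> C v -> 0 <= s -> 0 <= t ->
    usphere x -> x = s *: u + t *: v -> C x).

(* A nonempty spherically convex set that is open in the great k-sphere cut
   out by a linear subspace W of dimension k + 1. *)
Definition open_spherical_cell (k : int) C : Prop :=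
  [/\ C !=set0, spherically_convex C &
    exists W : {vspace V}, (\dim W)%:Z = k + 1 /\
      exists2 O : set V, open O & C = O `&` (usphere `&` [set u | u \in W])].

Definition transverse_antipodal P : Prop :=
  forall F G, exact_antipodal P (F, G) ->
    open_spherical_cell (d%:Z - 1 - affdim F - affdim G) (antipodal_cell P F G).

End Antipodal.

(* Main.v *)
(** The pair (F_P(u), F_P(-u)) labels every vector u; its value at u = 0 is
    (P, P), and its values at u <> 0 are the exact ordered antipodal pairs. The
    label depends only on the signs of <u, p_i - p_j>, for P the convex hull of
    the p_i, so its level sets are unions of cells of a linear hyperplane
    arrangement. Transversality says that the level set of (F, G) is a
    relatively open convex cone of dimension d - dim F - dim G. The sum
    of (-1)^dim over arrangement cells is additive and, because a hyperplane
    cutting a k-cell replaces (-1)^k by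
    (-1)^k + (-1)^(k-1) + (-1)^k, it equals (-1)^dim on every relatively open
    convex set. Summing over all labels, including {0}, gives (-1)^d. *)
From HB Require Import structures.
Require Import Defs.
From mathcomp Require Import all_boot all_order all_algebra.
From mathcomp Require Import all_classical all_reals all_analysis.
From mathcomp Require Import ring lra.

Import Order.TTheory GRing.Theory Num.Theory.
Import numFieldNormedType.Exports.

Local Open Scope classical_set_scope.
Local Open Scope ring_scope.

Set Implicit Arguments.
Unset Strict Implicit.

(** * Euler characteristic of hyperplane arrangements on open convex cells *)

Section EulerCharacteristic.
Context {R : realFieldType} {V : vectType R}.
Implicit Types (C : set V) (W : {vspace V}) (h : 'Hom(V, R^o)).

(* Openness of C in W is only required along lines; no topology on V is used. *)
Definition open_cell W C : Prop :=
  [/\ C !=set0, C `<=` [set` W],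
    forall u v t, C u -> C v -> 0 < t < 1 -> C (t *: u + (1 - t) *: v) &
    forall u w, C u -> w \in W ->
      exists2 e : R, 0 < e & forall t, `|t| <= e -> C (u + t *: w)].

(** From a point of [C], a short move along any [w] in [W] stays in [C] and hence in [W'], so the
    difference of the two points puts [w] in [W']. *)
Lemma open_cell_sub W W' C : open_cell W C -> open_cell W' C -> (W <= W')%VS.
Proof.
move=> [[u Cu] _ _ Cop] [_ CW' _ _]; apply/subvP => w wW.
have [e e0 Ce] := Cop u w Cu wW.
have uW' := CW' _ Cu.
have : u + e *: w \in W' by apply: CW'; apply: Ce; rewrite gtr0_norm.
move=> /(rpredB)/(_ uW'); rewrite addrAC subrr add0r => /(memvZ e^-1).
by rewrite scalerA mulVf ?gt_eqF// scale1r.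
Qed.

(* By open_cell_sub the subspace of an open cell is unique; the junk value 0
   is taken on sets that are not open cells, in particular on the empty set. *)
Definition cell_sign C : int :=
  xget 0 [set z | exists2 W, open_cell W C & z = (-1) ^+ \dim W].

Lemma cell_signE W C : open_cell W C -> cell_sign C = (-1) ^+ \dim W.
Proof.
move=> WC; rewrite /cell_sign; case: xgetP => [z -> [W' W'C ->]|/(_ ((-1) ^+ \dim W))].
  congr (_ ^+ \dim _); apply/eqP; rewrite eqEsubv.
  by rewrite (open_cell_sub W'C WC) (open_cell_sub WC W'C).
by case; exists W.
Qed.

Lemma cell_sign0 : cell_sign set0 = 0.
Proof. by rewrite /cell_sign; case: xgetP => // z _ [W [[]]]. Qed.

Definition sign_part h (s : R) C := C `&` [set u | Num.sg (h u) = s].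

(* The sum of (-1)^dim over the intersections of C with the sign cells of hs. *)
Fixpoint chi (hs : seq 'Hom(V, R^o)) C : int :=
  if hs is h :: hs' then \sum_(s <- [:: 1; 0; -1]) chi hs' (sign_part h s C)
  else cell_sign C.

Lemma chi0 hs : chi hs set0 = 0.
Proof.
elim: hs => [|h hs IH] /=; first exact: cell_sign0.
by rewrite big1// => s _; rewrite /sign_part set0I.
Qed.

(** Splitting by a sign commutes with splitting by [f]. Once all signs are fixed, [f] is constant on
    what remains, so a single label contributes. *)
Lemma chi_partition hs C (T : choiceType) (f : V -> T) (r : seq T) :
  uniq r -> (forall u, C u -> f u \in r) ->
  (forall u v, C u -> C v ->
    (forall h, h \in hs -> Num.sg (h u) = Num.sg (h v)) -> f u = f v) ->
  chi hs C = \sum_(t <- r) chi hs (C `&` [set u | f u = t]).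
Proof.
move=> ur; elim: hs C => [|h hs IH] C fr fC /=.
  have [->|/set0P[u Cu]] := eqVneq C set0.
    by rewrite cell_sign0 big1// => t _; rewrite set0I cell_sign0.
  rewrite (bigD1_seq (f u)) ?fr//= [X in _ + X]big1 ?addr0.
    congr cell_sign; apply/seteqP; split=> [v Cv|v []//]; split=> //.
    exact: fC.
  move=> t tfu; rewrite (_ : _ `&` _ = set0) ?cell_sign0//.
  apply/seteqP; split => // v [Cv /= fv]; case/eqP: tfu; rewrite -fv.
  exact: fC.
rewrite exchange_big/=; apply: eq_bigr => s _; rewrite IH.
- by apply: eq_bigr => t _; rewrite /sign_part setIAC.
- by move=> u [/fr].
move=> u v [Cu us] [Cv vs] huv; apply: fC => // h'.
by rewrite inE => /predU1P[->|/huv//]; rewrite us vs.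
Qed.

Lemma open_cell_lker W C h : open_cell W C -> sign_part h 0 C !=set0 ->
  open_cell (W :&: lker h) (sign_part h 0 C).
Proof.
move=> [_ CW Ccv Cop] C0; split => //.
- move=> u [/CW Wu /eqP]; rewrite /= sgr_eq0 => hu.
  by rewrite memv_cap Wu memv_ker.
- move=> u v t [Cu /eqP hu] [Cv /eqP hv] t01; split; first exact: Ccv.
  move: hu hv; rewrite !sgr_eq0 => /eqP hu /eqP hv.
  by rewrite /= linearD !linearZ/= hu hv !scaler0 addr0 sgr0.
- move=> u w [Cu /eqP hu]; rewrite memv_cap memv_ker => /andP[wW /eqP hw].
  have [e e0 Ce] := Cop _ _ Cu wW; exists e => // t te; split; first exact: Ce.
  by rewrite /= linearD linearZ/= hw scaler0 addr0; exact/eqP.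
Qed.

Lemma open_cell_pos W C h : open_cell W C -> sign_part h 1 C !=set0 ->
  open_cell W (sign_part h 1 C).
Proof.
move=> [_ CW Ccv Cop] C1; split => //; first by move=> u [/CW].
- move=> u v t [Cu /eqP hu] [Cv /eqP hv] t01; split; first exact: Ccv.
  move: hu hv; rewrite !sgr_cp0 => hu hv.
  rewrite /= linearD !linearZ/=; apply/gtr0_sg; rewrite /GRing.scale/=.
  by case/andP: t01 => t0 t1; rewrite addr_gt0 ?mulr_gt0 ?subr_gt0.
- move=> u w [Cu /eqP]; rewrite sgr_cp0 => hu wW.
  have [e e0 Ce] := Cop _ _ Cu wW.
  have hw1 : 0 < `|h w| + 1 by rewrite ltr_wpDl.
  (* The second bound keeps the change [t * h w] smaller than [h u]; the added 1 keeps the quotient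
     meaningful when [h w] is 0. *)
  exists (Num.min e (h u / (`|h w| + 1))) => [|t].
    by rewrite lt_min e0 divr_gt0.
  rewrite le_min => /andP[te]; rewrite ler_pdivlMr// => th.
  split; first exact: Ce.
  rewrite /= linearD linearZ/=; apply/gtr0_sg; rewrite /GRing.scale/=.
  have [->|t0] := eqVneq t 0; first by rewrite mul0r addr0.
  suff: `|t * h w| < h u by rewrite ltr_norml addrC -ltrBlDr sub0r => /andP[].
  rewrite normrM; apply: lt_le_trans th.
  by rewrite ltr_pM2l ?normr_gt0// ltrDl.
Qed.

Lemma sign_partN h s C : sign_part (- h) s C = sign_part h (- s) C.
Proof.
apply/seteqP; split=> u [Cu /= hu]; split=> //=; first by rewrite -hu opp_lfunE sgrN opprK.
by rewrite opp_lfunE sgrN hu opprK.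
Qed.

(** Rank-nullity: the image of [W] under [h] is a nonzero subspace of a line, so it has dimension
    1. *)
Lemma dim_cap_lker W h : ~ (W <= lker h)%VS ->
  \dim W = (\dim (W :&: lker h)).+1.
Proof.
move=> Wh; rewrite -(limg_ker_dim h W) -addn1; congr addn.
apply/eqP; rewrite eqn_leq (leq_trans (dimvS (subvf _))) ?dimvf//=.
rewrite lt0n dimv_eq0; apply/negP => /eqP hW0; apply: Wh.
by rewrite lkerE hW0.
Qed.

(* A hyperplane that meets C without containing it cuts C into three cells, of
   dimensions k, k - 1 and k, and (-1)^k + (-1)^(k-1) + (-1)^k = (-1)^k; any
   other hyperplane leaves C in a single part. *)
Lemma chi_open_cell hs W C : open_cell W C -> chi hs C = (-1) ^+ \dim W.
Proof.
elim: hs W C => [|h hs IH] W C WC /=; first exact: cell_signE.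
have [_ CW Ccv Cop] := WC.
have part_pos s : s = 1 \/ s = -1 -> sign_part h s C !=set0 ->
    open_cell W (sign_part h s C).
  move=> [->|->]; first exact: open_cell_pos.
  by rewrite -sign_partN; exact: open_cell_pos.
have part_full s : (forall u, C u -> Num.sg (h u) = s) -> s \in [:: 1; 0; -1] ->
    \sum_(s' <- [:: 1; 0; -1]) chi hs (sign_part h s' C) = (-1) ^+ \dim W.
  move=> Cs sin; rewrite (bigD1_seq s)//=; last first.
    have /gt_eqF N10 := ltrN10 R; have /gt_eqF N11 := lt_trans (ltrN10 R) ltr01.
    by rewrite !inE oner_eq0 N10 N11.
  rewrite [X in _ + X]big1 ?addr0 => [|s' s's].
    rewrite (_ : sign_part h s C = C); first exact: IH.
    by apply/seteqP; split=> [u []//|u Cu]; split=> //; exact: Cs.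
  rewrite (_ : sign_part h s' C = set0) ?chi0//.
  apply/seteqP; split=> // u [/Cs /= us us']; by rewrite -us' us eqxx in s's.
have [/subvP Wh|/negP Wh] := boolP (W <= lker h)%VS.
  apply: (part_full 0); last by rewrite !inE eqxx orbT.
  by move=> u /CW /Wh; rewrite memv_ker => /eqP ->; rewrite sgr0.
have [C0|/set0P[u0 [Cu0 /eqP]]] := eqVneq (sign_part h 0 C) set0.
  have no0 u : C u -> h u != 0.
    move=> Cu; apply/negP => /eqP hu; suff: set0 u by [].
    by rewrite -C0; split => //=; rewrite hu sgr0.
  have [u Cu] : C !=set0 by case: WC.
  have hu0 := no0 _ Cu.
  apply: (part_full (Num.sg (h u))); last first.
    by rewrite !inE; case: sgrP; rewrite ?eqxx ?orbT.
  move=> v Cv; have hv0 := no0 _ Cv; apply/eqP; apply: contraT => sne.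
  have huv : h v * h u < 0.
    move: sne; case: (ltgtP (h v) 0) hv0 => //; case: (ltgtP (h u) 0) hu0 => //.
    - by move=> a _ b _; rewrite !ltr0_sg// eqxx.
    - by move=> a _ b _ _; rewrite nmulr_rlt0.
    - by move=> a _ b _ _; rewrite pmulr_rlt0.
    - by move=> a _ b _; rewrite !gtr0_sg// eqxx.
  have hne : h u - h v != 0.
    by apply: contraTneq huv => /eqP; rewrite subr_eq0 => /eqP ->; rewrite -leNgt sqr_ge0.
  (* The zero of [h] on the segment joining two points of opposite sign; by convexity it lies in
     [C], against [no0]. *)
  pose t := h u / (h u - h v).
  have t01 : 0 < t < 1.
    rewrite /t; have [d0|d0] := ltP 0 (h u - h v).
      rewrite ltr_pdivrMr// divr_gt0//; nra.
    have {}d0 : h u - h v < 0 by rewrite lt_neqAle hne.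
    rewrite ltr_ndivrMr// mul1r; apply/andP; split; last nra.
    rewrite -mulrNN -invrN divr_gt0 ?oppr_gt0//; nra.
  have := no0 _ (Ccv _ _ _ Cv Cu t01); rewrite linearD !linearZ/= /GRing.scale/= /t.
  by case/eqP; field.
rewrite sgr_eq0 => /eqP hu0.
have [w wW hw] : exists2 w, w \in W & h w != 0.
  apply: contrapT => ne; apply: Wh; apply/subvP => w wW; rewrite memv_ker.
  by apply: contrapT => hw; apply: ne; exists w => //; exact/negP.
have part_ne s : s = 1 \/ s = -1 -> sign_part h s C !=set0.
  move=> s1; have [e e0 Ce] := Cop _ _ Cu0 wW.
  (* The factor [Num.sg (h w)] cancels the sign of [h w], so [h] takes the value [e * s] times the
     absolute value of [h w]. *)
  exists (u0 + (e * s * Num.sg (h w)) *: w); split.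
    apply: Ce; rewrite !normrM normr_sg hw mulr1 (gtr0_norm e0).
    by case: s1 => ->; rewrite ?normrN normr1 mulr1.
  rewrite /= linearD linearZ/= hu0 add0r /GRing.scale/= !sgrM sgr_id.
  rewrite (gtr0_sg e0) mul1r -mulrA -expr2 sqr_sg hw mulr1.
  by case: s1 => ->; rewrite ?sgrN sgr1.
rewrite !big_cons big_nil addr0.
rewrite (IH W (sign_part h 1 C)); last by apply: part_pos; [left|apply: part_ne; left].
rewrite (IH W (sign_part h (-1) C)); last by apply: part_pos; [right|apply: part_ne; right].
rewrite (IH (W :&: lker h)%VS); last first.
  by apply: open_cell_lker => //; exists u0; split => //=; rewrite hu0 sgr0.
by rewrite (dim_cap_lker Wh) exprS mulN1r subrr addr0.
Qed.

(** Both sides are [chi hs] of the whole space: directly by [chi_open_cell], and label by label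
    after [chi_partition]. *)
Theorem euler_relation (hs : seq 'Hom(V, R^o)) (T : choiceType) (f : V -> T)
    (r : seq T) (W : T -> {vspace V}) :
  (forall u v, (forall h, h \in hs -> Num.sg (h u) = Num.sg (h v)) ->
    f u = f v) ->
  uniq r -> (forall u, f u \in r) ->
  (forall t, t \in r -> open_cell (W t) [set u | f u = t]) ->
  \sum_(t <- r) (-1) ^+ \dim (W t) = (-1) ^+ dim V :> int.
Proof.
move=> fh ur fr cells.
have cellT : open_cell fullv [set: V].
  split => //; first by exists 0.
    by move=> u _ /=; rewrite memvf.
  by move=> u w _ _; exists 1.
rewrite -dimvf -(chi_open_cell hs cellT) (chi_partition (f := f) ur)//.
  rewrite !big_seq; apply: eq_bigr => t tr; rewrite setTI.
  by rewrite (chi_open_cell hs (cells t tr)).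
by move=> u v _ _; exact: fh.
Qed.

End EulerCharacteristic.

(** * The inner product and radial projection to the unit sphere *)

Section DotProduct.
Context {R : realType} {d : nat}.
Implicit Types u v w : 'rV[R]_d.

Lemma dotpE u v : dotp u v = \sum_i u 0 i * v 0 i.
Proof. by rewrite /dotp mxE; apply: eq_bigr => i _; rewrite mxE. Qed.

Lemma dotpC u v : dotp u v = dotp v u.
Proof. by rewrite !dotpE; apply: eq_bigr => i _; rewrite mulrC. Qed.

(** The fixed vector comes first, so that the partial application is a linear form that [linfun] can
    bundle. *)
Definition dotpr v u : R^o := dotp u v.

Lemma dotpr_is_linear v : linear (dotpr v).
Proof. by move=> a x y; rewrite /dotpr /dotp mulmxDl -scalemxAl !mxE. Qed.

HB.instance Definition _ v :=
  GRing.isLinear.Build R 'rV[R]_d R^o *:%R (dotpr v) (dotpr_is_linear v).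

Lemma dotpDl u v w : dotp (u + v) w = dotp u w + dotp v w.
Proof. exact: (linearD (dotpr w)). Qed.

Lemma dotpNl u w : dotp (- u) w = - dotp u w.
Proof. exact: (linearN (dotpr w)). Qed.

Lemma dotpZl a u w : dotp (a *: u) w = a * dotp u w.
Proof. exact: (linearZ_LR (dotpr w)). Qed.

Lemma dotp0l w : dotp 0 w = 0.
Proof. exact: (linear0 (dotpr w)). Qed.

Lemma dotpDr u v w : dotp w (u + v) = dotp w u + dotp w v.
Proof. by rewrite !(dotpC w) dotpDl. Qed.

Lemma dotpBr u v w : dotp w (u - v) = dotp w u - dotp w v.
Proof. by rewrite !(dotpC w) dotpDl dotpNl. Qed.

Lemma dotpZr a u w : dotp w (a *: u) = a * dotp w u.
Proof. by rewrite !(dotpC w) dotpZl. Qed.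

Lemma dotp_sumr n (c : 'I_n -> R) (p : 'I_n -> 'rV[R]_d) u :
  dotp u (\sum_i c i *: p i) = \sum_i c i * dotp u (p i).
Proof.
rewrite dotpC [LHS](linear_sum (dotpr u)).
by apply: eq_bigr => i _; rewrite -[LHS]/(dotp (c i *: p i) u) dotpZl dotpC.
Qed.

Lemma dotp_ge0 u : 0 <= dotp u u.
Proof. by rewrite dotpE; apply: sumr_ge0 => i _; rewrite -expr2 sqr_ge0. Qed.

Lemma dotp_eq0 u : (dotp u u == 0) = (u == 0).
Proof.
apply/idP/idP => [|/eqP->]; last by rewrite dotp0l.
rewrite dotpE psumr_eq0 => [/allP u0|i _]; last by rewrite -expr2 sqr_ge0.
apply/eqP/rowP => i; have := u0 i; rewrite mem_index_enum => /(_ isT).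
by rewrite -expr2 sqrf_eq0 mxE => /eqP.
Qed.

Lemma dotp_gt0 u : (0 < dotp u u) = (u != 0).
Proof. by rewrite lt0r dotp_eq0 dotp_ge0 andbT. Qed.

Definition normalize u := (Num.sqrt (dotp u u))^-1 *: u.

Lemma normalize_scale_gt0 u : u != 0 -> 0 < (Num.sqrt (dotp u u))^-1.
Proof. by rewrite invr_gt0 sqrtr_gt0 dotp_gt0. Qed.

Lemma usphere_normalize u : u != 0 -> usphere (normalize u).
Proof.
move=> u0; have s0 : Num.sqrt (dotp u u) != 0 by rewrite gt_eqF ?sqrtr_gt0 ?dotp_gt0.
rewrite /usphere/= /normalize dotpZl dotpZr -[X in _ * (_ * X)](sqr_sqrtr (dotp_ge0 u)).
by rewrite expr2 mulKf// mulVf.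
Qed.

Lemma usphere_neq0 u : usphere u -> u != 0.
Proof.
by rewrite /usphere/= => uu; apply/negP => /eqP u0; have := oner_neq0 R; rewrite -uu u0 dotp0l eqxx.
Qed.

Lemma line_continuous u w : u + t *: w @[t --> (0 : R)] --> u.
Proof.
rewrite -[X in _ --> X]addr0 -(scale0r w).
by apply: cvgD; [exact: cvg_cst|apply: cvgZr_tmp; exact: cvg_id].
Qed.

(** Transfers openness on the sphere to openness along lines, the form required by [open_cell]. *)
Lemma normalize_line_continuous u w : u != 0 ->
  (normalize (u + t *: w)) @[t --> (0:R)] --> normalize u.
Proof.
move=> u0.
have quad : dotp (u + t *: w) (u + t *: w) @[t --> (0 : R)] --> dotp u u.
  (* Along the line the squared norm is a quadratic polynomial in [t]. *)
  have -> : (fun t => dotp (u + t *: w) (u + t *: w)) =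
      (fun t => dotp u u + t * (dotp u w *+ 2 + t * dotp w w)).
    apply/funext => t; rewrite dotpDl !dotpDr !dotpZl !dotpZr (dotpC w u); ring.
  have : (dotp u u + t * (dotp u w *+ 2 + t * dotp w w)) @[t --> (0 : R)]
      --> dotp u u + 0 * (dotp u w *+ 2 + 0 * dotp w w).
    apply: cvgD; first exact: cvg_cst.
    apply: cvgM; first exact: cvg_id.
    apply: cvgD; first exact: cvg_cst.
    by apply: cvgM; [exact: cvg_id|exact: cvg_cst].
  by rewrite mul0r addr0.
apply: cvgZ; last exact: line_continuous.
apply: cvgV; first by rewrite gt_eqF// sqrtr_gt0 dotp_gt0.
exact: (cvg_comp _ _ quad (@sqrt_continuous _ _)).
Qed.

End DotProduct.

(** * Support faces of convex hulls *)

Section SupportFaces.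
Context {R : realType} {d : nat}.
Implicit Types (P F : set 'rV[R]_d) (u v x : 'rV[R]_d).

Lemma support_faceZ P u (c : R) : 0 < c ->
  support_face P (c *: u) = support_face P u.
Proof.
by move=> c0; apply/seteqP; split=> x [Px xmax]; split=> // y /xmax;
  rewrite !dotpZl ler_pM2l.
Qed.

Lemma support_face0 P : support_face P 0 = P.
Proof.
by apply/seteqP; split=> [x []//|x Px]; split=> // y _; rewrite !dotp0l.
Qed.

(** A point of [F] maximizes both forms, so a maximizer of the sum must maximize each of them. This
    yields convexity of the cones of equal label. *)
Lemma support_faceD P F u v : F !=set0 ->
  support_face P u = F -> support_face P v = F -> support_face P (u + v) = F.
Proof.
move=> [y Fy] uF vF; apply/seteqP; split=> x.
  have [Py yu] : support_face P u y by rewrite uF.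
  have [_ yv] : support_face P v y by rewrite vF.
  move=> [Px xmax]; rewrite -uF; split=> // z Pz.
  have := xmax _ Py; rewrite !dotpDl.
  have := yu _ Pz; have := yu _ Px; have := yv _ Px; lra.
move=> Fx.
have [Px xu] : support_face P u x by rewrite uF.
have [_ xv] : support_face P v x by rewrite vF.
by split=> // z Pz; rewrite !dotpDl lerD ?xu ?xv.
Qed.

Lemma vertex_in_convhull n (p : 'I_n -> 'rV[R]_d) i : convhull p (p i).
Proof.
exists (fun j => (j == i)%:R); split.
- by move=> j; rewrite ler0n.
- by rewrite (bigD1 i)//= eqxx big1 ?addr0// => j /negbTE ->.
- by rewrite (bigD1 i)//= eqxx scale1r big1 ?addr0// => j /negbTE ->; rewrite scale0r.
Qed.

(** The weighted gaps to the maximum are nonnegative and sum to 0, so nonzero weights sit only on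
    maximizing [p i]. In this description [u] enters only through comparisons of its values at the
    [p i]. *)
Lemma support_face_convhull n (p : 'I_n -> 'rV[R]_d) u :
  support_face (convhull p) u = [set x | exists w : 'I_n -> R,
    [/\ forall i, 0 <= w i, \sum_i w i = 1,
        forall i, w i != 0 -> forall j, dotp u (p j) <= dotp u (p i) &
        x = \sum_i w i *: p i]].
Proof.
apply/seteqP; split=> x.
  move=> [[w [w0 w1 xE]] xmax]; exists w; split=> // i wi0 j.
  suff -> : dotp u (p i) = dotp u x by apply: xmax; exact: vertex_in_convhull.
  have /psumr_eq0P : \sum_k w k * (dotp u x - dotp u (p k)) = 0.
    under eq_bigr do rewrite mulrBr.
    by rewrite sumrB -mulr_suml w1 mul1r {1}xE dotp_sumr subrr.
  have gap0 k : true -> 0 <= w k * (dotp u x - dotp u (p k)).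
    by rewrite mulr_ge0// subr_ge0; apply: xmax; exact: vertex_in_convhull.
  move=> /(_ gap0 i isT)/eqP.
  by rewrite mulf_eq0 (negbTE wi0) subr_eq0 => /eqP.
move=> [w [w0 w1 wmax xE]]; split; first by exists w.
have [i wi0] : exists i, w i != 0.
  apply: contrapT => wn; have := oner_neq0 R; rewrite -w1 big1 ?eqxx// => i _.
  by apply/eqP; apply: contrapT => wi; apply: wn; exists i; exact/negP.
have -> : dotp u x = dotp u (p i).
  rewrite xE dotp_sumr -[RHS]mul1r -w1 mulr_suml; apply: eq_bigr => k _.
  have [->|wk0] := eqVneq (w k) 0; first by rewrite !mul0r.
  by congr (_ * _); apply/eqP; rewrite eq_le (wmax i wi0) (wmax k wk0).
move=> _ [v [v0 v1 ->]]; rewrite dotp_sumr -[leRHS]mul1r -v1 mulr_suml.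
by apply: ler_sum => k _; rewrite ler_wpM2l// wmax.
Qed.

Lemma support_face_eq n (p : 'I_n -> 'rV[R]_d) u v :
  (forall i j, (dotp u (p j) <= dotp u (p i)) = (dotp v (p j) <= dotp v (p i))) ->
  support_face (convhull p) u = support_face (convhull p) v.
Proof.
move=> uv; rewrite !support_face_convhull; apply/seteqP; split=> x [w [w0 w1 wm xE]];
  by exists w; split=> // i wi j; have := wm i wi j; rewrite uv.
Qed.

Lemma support_face_neq0 n (p : 'I_n -> 'rV[R]_d) u :
  convhull p !=set0 -> support_face (convhull p) u !=set0.
Proof.
case: n p => [|n] p [x [w [_ w1 _]]].
  by have := oner_neq0 R; rewrite -w1 big_ord0 eqxx.
exists (p [arg max_(i > ord0) dotp u (p i)]%O); case: arg_maxP => // i _ imax.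
split; first exact: vertex_in_convhull.
move=> _ [v [v0 v1 ->]]; rewrite dotp_sumr -[leRHS]mul1r -v1 mulr_suml.
by apply: ler_sum => k _; rewrite ler_wpM2l//; exact: imax.
Qed.

Lemma is_face_support P u : support_face P u !=set0 -> is_face P (support_face P u).
Proof.
move=> [y [Py ymax]]; exists u, (dotp u y); split=> [x Px|]; first exact: ymax.
apply/seteqP; split=> x [Px xu]; split=> //=.
  by apply/eqP; rewrite eq_le xu// ymax.
by move=> z Pz; rewrite xu ymax.
Qed.

Lemma full_affhull P : affdim P = d%:Z -> affhull P = setT.
Proof.
(* The default -1 of [affdim] differs from [d%:Z], so a genuine direction space exists; its
   dimension makes it the full space. *)
rewrite /affdim; case: xgetP => [z _ [x0 [W [-> ->]]] [dW]|//].
apply/seteqP; split=> // x _ /=.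
suff -> : W = fullv by rewrite memvf.
by apply/eqP; rewrite eqEdim subvf dimvf dim_matrix [X in (X <= _)%N]mul1n dW/=.
Qed.

Lemma full_nonempty P : affdim P = d%:Z -> P !=set0.
Proof.
move=> dimP; have : affhull P 0 by rewrite full_affhull.
case=> -[|n] [p [w [Pp w1 _]]]; last by exists (p ord0).
by have := oner_neq0 R; rewrite -w1 big_ord0 eqxx.
Qed.

(** The form [dotp u] is constant on [P], hence on its affine hull, the whole space; comparing its
    values at [u] and 0 gives [dotp u u = 0]. *)
Lemma support_face_full P u : affdim P = d%:Z -> support_face P u = P -> u = 0.
Proof.
move=> dimP uP; have [y Py] := full_nonempty dimP.
have PT := full_affhull dimP.
have cst x x' : P x -> P x' -> dotp u x = dotp u x'.
  move=> Px Px'; apply/eqP; rewrite eq_le.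
  have [_ ->//] : support_face P u x' by rewrite uP.
  by have [_ ->//] : support_face P u x by rewrite uP.
have u_cst x : dotp u x = dotp u y.
  have [n [p [w [Pp w1 ->]]]] : affhull P x by rewrite PT.
  rewrite dotp_sumr -[RHS]mul1r -w1 mulr_suml; apply: eq_bigr => i _.
  by rewrite (cst _ _ (Pp i) Py).
apply/eqP; rewrite -dotp_eq0 (u_cst u) -(u_cst 0).
by rewrite dotpC dotp0l.
Qed.

End SupportFaces.

(** * Auxiliary facts on finiteness and signs *)

Lemma finite_range_factor (A : pointedType) (B : Type) (T : finType) (f : A -> B) (g : A -> T) :
  (forall u v, g u = g v -> f u = f v) -> finite_set (range f).
Proof.
move=> gf; pose phi y := f (xget point [set u | g u = y]).
apply: (@sub_finite_set _ _ (phi @` [set: T])).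
  move=> _ [u _ <-]; exists (g u) => //; apply: gf.
  by have /(xgetPex point) : exists v, g v = g u by exists u.
exact/finite_image/finite_finset.
Qed.

(** Passing from a spherical cell to the cone over it raises the dimension by one and flips the
    sign. The exponent [k] is an integer because it is -1 when [n] is 0. *)
Lemma signz_succ (k : int) (n : nat) :
  n%:Z = k + 1 -> (-1 : int) ^ k = - (-1) ^+ n.
Proof.
move=> nk; have -> : k = n%:Z - 1 by rewrite nk addrK.
by rewrite exprzDr ?unitrN1// mulrN1.
Qed.

(** * Antipodal cells and the cones over them *)

Section AntipodalCells.
Context {R : realType} {d : nat}.
Implicit Types (P F G : set 'rV[R]_d) (u v : 'rV[R]_d).

Definition support_pair P u := (support_face P u, support_face P (- u)).

Lemma support_pair_normalize P u : u != 0 ->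
  support_pair P (normalize u) = support_pair P u.
Proof.
move=> u0; rewrite /support_pair /normalize -scalerN.
by rewrite !support_faceZ ?normalize_scale_gt0.
Qed.

Lemma antipodal_cellE P F G :
  antipodal_cell P F G = usphere `&` [set u | support_pair P u = (F, G)].
Proof.
apply/seteqP; split=> u.
  move=> [[uS uF] [v [_ vG] vu]]; split=> //=.
  by rewrite /support_pair uF -vu opprK vG.
move=> [uS [uF uG]]; split=> //; exists (- u); last by rewrite opprK.
by split=> //; rewrite /usphere/= dotpNl dotpC dotpNl opprK.
Qed.

Lemma exact_antipodal_support n (p : 'I_n -> 'rV[R]_d) u :
  affdim (convhull p) = d%:Z -> convhull p !=set0 -> u != 0 ->
  exact_antipodal (convhull p) (support_pair (convhull p) u).
Proof.
move=> dimP P0 u0.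
have proper v : v != 0 -> nonempty_proper_face (convhull p) (support_face (convhull p) v).
  move=> v0; have F0 := support_face_neq0 v P0.
  split=> //; first exact: is_face_support.
  by move=> /(support_face_full dimP)/eqP; apply/negP.
split; [exact: proper|by apply: proper; rewrite oppr_eq0|].
rewrite antipodal_cellE; exists (normalize u).
by split; [exact: usphere_normalize|rewrite /= support_pair_normalize].
Qed.

(** The level set is the cone over the antipodal cell, hence the extra 1 in the dimension. Convexity
    comes from [support_faceD], openness from continuity of [normalize]. *)
Lemma open_cell_support_pair P F G : transverse_antipodal P ->
  exact_antipodal P (F, G) ->
  exists2 W : {vspace 'rV[R]_d}, (\dim W)%:Z = d%:Z - 1 - affdim F - affdim G + 1 &
    open_cell W [set u | support_pair P u = (F, G)].
Proof.
move=> tP FGe; have [[_ F0 FP] [_ G0 _]] := FGe.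
rewrite /= antipodal_cellE => -[u1 [_ u1FG]].
have [_ _ [W [dW [U Uo UE]]]] := tP _ _ FGe; rewrite antipodal_cellE in UE.
exists W => //.
(* The vector 0 has label [(P, P)], while [F] is proper. *)
have neq0 u : support_pair P u = (F, G) -> u != 0.
  by move=> [uF _]; apply/eqP => u0'; apply: FP; rewrite -uF u0' support_face0.
have memW u : support_pair P u = (F, G) -> U (normalize u) /\ u \in W.
  move=> uFG; have uneq := neq0 _ uFG.
  have : (U `&` (usphere `&` [set u | u \in W])) (normalize u).
    rewrite -UE; split; first exact: usphere_normalize.
    by rewrite /= support_pair_normalize.
  move=> [Uu [_ /= uW]]; split=> //.
  have /gt_eqF c0 := normalize_scale_gt0 uneq.
  by move: uW; rewrite /normalize rpredZeq c0.
split.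
- by exists u1.
- by move=> u /memW[].
- move=> u v t [uF uG] [vF vG] /andP[t0 t1]; have t1' : 0 < 1 - t by rewrite subr_gt0.
  rewrite /= /support_pair; congr pair.
    by apply: support_faceD; rewrite ?support_faceZ.
  by rewrite opprD -!scalerN; apply: support_faceD; rewrite ?support_faceZ.
- move=> u w uFG wW; have uneq := neq0 _ uFG; have [Uu uW] := memW _ uFG.
  have Unbhs : nbhs (normalize u) U by apply: open_nbhs_nbhs.
  have near_neq0 : \forall t \near (0 : R), u + t *: w != 0.
    exact: (cvgr_neq0 u (@line_continuous R d u w) uneq).
  have near_U := @normalize_line_continuous R d u w uneq _ Unbhs.
  have /nbhs_ballP[e /= e0 eS] : nbhs (0 : R)
      ([set t | u + t *: w != 0] `&` [set t | U (normalize (u + t *: w))]).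
    exact: filterI.
  (* Halving fits the closed interval of [open_cell] inside the open ball. *)
  exists (e / 2) => [|t te]; first by rewrite divr_gt0.
  have /eS[tneq /= tU] : ball (0 : R) e t.
    by rewrite /ball/= sub0r normrN (le_lt_trans te)// ltr_pdivrMr// ltr_pMr// ltr1n.
  rewrite /= -support_pair_normalize//.
  suff [] : (usphere `&` [set u | support_pair P u = (F, G)]) (normalize (u + t *: w)) by [].
  rewrite UE; split=> //; split; first exact: usphere_normalize.
  by rewrite /= /normalize memvZ// memvD// memvZ.
Qed.

End AntipodalCells.

(** * The alternating sum over exact antipodal pairs *)

Unset Implicit Arguments.
Set Strict Implicit.

Theorem theorem4p2 (R : realType) (d : nat) (P : set 'rV[R]_d) :
  convex_dpolytope P -> transverse_antipodal P ->
  \sum_(FG \in exact_antipodal P)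
     (-1 : int) ^ (d%:Z - 1 - affdim FG.1 - affdim FG.2)
  = 1 + (-1 : int) ^ (d%:Z - 1).
Proof.
move=> [[n [p PE]] dimP] tP.
have P0 := full_nonempty dimP.
have exactE t : exact_antipodal P t -> exists2 u, support_pair P u = t & u != 0.
  case: t => F G [_ _ [u]]; rewrite antipodal_cellE => -[uS uFG].
  by exists u => //; exact: usphere_neq0.
have exact_pair u : u != 0 -> exact_antipodal P (support_pair P u).
  by move=> u0; rewrite PE; apply: exact_antipodal_support; rewrite -?PE.
have PP_exact : ~ exact_antipodal P (P, P) by case=> -[].
(* The comparisons of [u] at the generators take finitely many values and determine the label, so
   there are finitely many exact pairs. *)
pose le_vert u := [set ij : 'I_n * 'I_n | dotp u (p ij.2) <= dotp u (p ij.1)]%SET.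
have pair_le_vert u v : le_vert u = le_vert v -> support_pair P u = support_pair P v.
  move=> uv; have {}uv i j : (dotp u (p j) <= dotp u (p i)) = (dotp v (p j) <= dotp v (p i)).
    by have /setP/(_ (i, j)) := uv; rewrite !inE.
  rewrite PE /support_pair; congr pair; apply: support_face_eq => i j //.
  by rewrite !dotpNl !lerN2.
have fin : finite_set (exact_antipodal P).
  apply: sub_finite_set (finite_range_factor pair_le_vert).
  by move=> t /exactE[u <- _]; exists u.
(* Each exact pair gets the span of its cone, and [(P, P)] gets the zero space, the span of its
   level set. *)
have /choice[W WP] (t : set 'rV[R]_d * set 'rV[R]_d) : exists W : {vspace 'rV[R]_d},
    (exact_antipodal P t -> (\dim W)%:Z = d%:Z - 1 - affdim t.1 - affdim t.2 + 1 /\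
       open_cell W [set u | support_pair P u = t]) /\
    (t = (P, P) -> W = 0%VS).
  case: (pselect (exact_antipodal P t)) => [te|tne].
    case: t te => F G te; have [W dW Wc] := open_cell_support_pair tP te.
    by exists W; split=> // tPP; rewrite tPP in te.
  by exists 0%VS.
(* The signs of these forms decide every comparison recorded by [le_vert]. *)
pose forms := [seq linfun (dotpr (p ij.1 - p ij.2)) | ij : 'I_n * 'I_n].
pose r : seq (set 'rV[R]_d * set 'rV[R]_d) :=
  finmap.enum_fset (fset_set (exact_antipodal P)).
have r_exact t : (t \in r) = (t \in exact_antipodal P).
  exact: in_fset_set.
have := @euler_relation _ _ forms _ (support_pair P) ((P, P) :: r) W.
rewrite big_cons dim_matrix [(1%N * d)%R]mul1n (WP (P, P)).2// dimv0 expr0.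
move=> eul; rewrite fsbig_finite// -/r.
(* The right-hand side becomes 1 minus the Euler sum, and the term of [(P, P)] in that sum cancels
   the 1. What is left is the sum over exact pairs with every sign flipped. *)
rewrite (@signz_succ _ d) ?subrK// -eul.
- rewrite opprD addrA subrr add0r -sumrN !big_seq; apply: eq_bigr => t.
  rewrite r_exact => /set_mem te; apply: signz_succ.
  exact: ((WP t).1 te).1.
- move=> u v uv; apply: pair_le_vert; apply/setP => -[i j]; rewrite !inE.
  have /uv : linfun (dotpr (p i - p j)) \in forms.
    by apply/mapP; exists (i, j); rewrite ?mem_enum.
  rewrite !lfunE/= /dotpr => sguv.
  by rewrite -!(subr_ge0 (dotp _ (p j))) -!dotpBr -sgr_ge0 sguv sgr_ge0.
- rewrite /= finmap.fset_uniq andbT r_exact; apply/negP => /set_mem; exact: PP_exact.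
- move=> u; rewrite inE r_exact; have [->|u0] := eqVneq u 0.
    by rewrite /support_pair oppr0 support_face0 eqxx.
  by rewrite mem_set ?orbT//; exact: exact_pair.
- move=> t; rewrite inE r_exact => /predU1P[->|/set_mem te]; last exact: ((WP t).1 te).2.
  rewrite (WP (P, P)).2//.
  (* By [support_face_full], only 0 has the label [(P, P)]. *)
  rewrite (_ : [set u | _] = [set 0]).
    split=> [|u -> /=|u v t' -> -> _ /=|u w -> ] /=.
    - by exists 0.
    - by rewrite mem0v.
    - by rewrite !scaler0 addr0.
    - by rewrite memv0 => /eqP ->; exists 1 => // t' _; rewrite scaler0 addr0.
  apply/seteqP; split=> u /=; last by move=> ->; rewrite /support_pair oppr0 support_face0.
  by move=> [/(support_face_full dimP)].
Qed.
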